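(* Let $0<p<\infty$ and let $w:[0,1]\to[0,\infty)$ be a non-decreasing function with $w(1)=1$ satisfying the doubling condition: there is a constant $C_0\ge 1$ such that $w(2t)\le C_0\,w(t)$ for all $t\in(0,1/2]$. Then there is a constant $C\ge 1$, depending only on $p$ and $w$, such that for every real sequence $\{a_k\}_{k=1}^\infty\in l_2$ $$C^{-1}\Big(\|\{a_k\}\|_{l_2}+\sup_{m\in\mathbb N} w(2^{-m})\sum_{k=1}^m|a_k|\Big)\le \Big\|\sum_{k=1}^\infty a_k r_k\Big\|_{M_{p,w}}\le C\Big(\|\{a_k\}\|_{l_2}+\sup_{m\in\mathbb N} w(2^{-m})\sum_{k=1}^m|a_k|\Big),$$ where the quantities are allowed to take the value $+\infty$.
   Context: For a measurable $f:[0,1]\to\mathbb R$, $$\|f\|_{M_{p,w}}=\sup_I w(|I|)\Big(\frac1{|I|}\int_I|f(t)|^p\,dt\Big)^{1/p},$$ the supremum being over all (non-degenerate) intervals $I\subset[0,1]$, where $|I|$ is the Lebesgue measure of $I$. The Morrey space $M_{p,w}$ consists of all (a.e. classes of) such $f$ with $\|f\|_{M_{p,w}}<\infty$. The Rademacher functions are $r_k(t)=\mathrm{sign}(\sin 2^k\pi t)$, $k\in\mathbb N=\{1,2,\dots\}$, $t\in[0,1]$. For $\{a_k\}\in l_2$ the series $\sum_k a_k r_k$ converges a.e. and denotes its a.e. sum. *)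

(* Defs.v *)
(* MathComp-Analysis *)
From HB Require Import structures.
From mathcomp Require Import all_boot all_order all_algebra.
From mathcomp Require Import all_classical all_reals all_analysis.

Set Implicit Arguments.
Unset Strict Implicit.
Unset Printing Implicit Defensive.

Import Order.TTheory GRing.Theory Num.Theory.
Import numFieldNormedType.Exports.

Local Open Scope classical_set_scope.
Local Open Scope ring_scope.

Definition rademacher {R : realType} (k : nat) (t : R) : R :=
  Num.sg (sin (2 ^+ k * pi * t)).

(* Sequences {a_k}_{k >= 1} are functions nat -> R whose value at 0 is never
   used. *)

(* At the points t where the partial sums diverge, limn returns a fixed
   default value; when a is in l_2 these points form a null set, so this is a
   representative of the a.e. class of the sum. *)
Definition rademacher_sum {R : realType} (a : nat -> R) (t : R) : R :=
  limn (fun n : nat => \sum_(1 <= k < n.+1) a k * rademacher k t).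

Definition l2norm {R : realType} (a : nat -> R) : \bar R :=
  sqrte (\sum_(1 <= k <oo) ((a k) ^+ 2)%:E)%E.

Definition weighted_l1_sup {R : realType} (w : R -> R) (a : nat -> R) : \bar R :=
  ereal_sup [set (w (2 ^- m) * \sum_(1 <= k < m.+1) `|a k|)%:E
            | m in [set m : nat | (1 <= m)%N]].

(* I ranges over open, closed and half-open intervals alike; positive measure
   expresses non-degeneracy. *)
Definition nondeg_subinterval01 {R : realType} (I : set R) : Prop :=
  [/\ is_interval I, I `<=` `[0, 1] & (0 < lebesgue_measure I)%E].

(* The supremum is taken in \bar R, and is +oo when f is not in M_{p,w}. *)
Definition morrey_norm {R : realType} (p : R) (w : R -> R) (f : R -> R) :
    \bar R :=
  ereal_sup [set (let l := fine (lebesgue_measure I) in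
      (w l)%:E *
      (l^-1%:E * \int[lebesgue_measure]_(t in I) (`|f t| `^ p)%:E) `^ p^-1)%E
    | I in [set I : set R | nondeg_subinterval01 I]].

(* Main.v *)
Require Import Defs.
From HB Require Import structures.
From mathcomp Require Import all_boot all_order all_algebra.
From mathcomp Require Import all_classical all_reals all_analysis.
From mathcomp Require Import measurable_realfun ring lra.
Import Order.TTheory GRing.Theory Num.Theory.
Import numFieldNormedType.Exports.
Local Open Scope classical_set_scope.
Local Open Scope ring_scope.

Set Implicit Arguments.
Unset Strict Implicit.
Unset Printing Implicit Defensive.

(** On a dyadic interval J of rank m the functions r_1, ..., r_m are constant,
    while r_(m+1), r_(m+2), ... behave on J, for normalised Lebesgue measure,
    like independent fair signs.  So f = sum a_k r_k is on J a constant, of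
    modulus at most sum_(k <= m) |a_k|, plus a random sum whose moments are
    governed by the l_2 norm of a.

    Upper bound.  An interval I with 2^-(m+1) < |I| <= 2^-m is covered by two
    dyadic intervals of rank m, and on each of them the p-th mean of |f| is at
    most a constant times sum_(k <= m) |a_k| + 2 ||a||_2, by exponential
    integrability of random sums ([sign_mean_cosh],
    [integral_block_powR_le]) and Fatou's lemma
    ([integral_rademacher_sum_le]).  Since w is nondecreasing and w <= 1, the
    factor w(|I|) turns this into the right-hand side.

    Lower bound.  On ]0, 1[ a fourth moment argument of Paley-Zygmund type
    shows that |f| is at least ||a||_2 / 2 on a set of measure bounded below
    ([measure_block_ge_l2]).  For given m there is a dyadic interval of rank m
    where a_k r_k = |a_k| for all k <= m; the tail of the series is symmetric
    there, so f >= sum_(k <= m) |a_k| on at least half of that interval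
    ([measure_block_ge_l1]).

    Randomness enters only through a finite recursion: integrating over J a
    function of a_(m+1) r_(m+1) + ... + a_(m+n) r_(m+n) means averaging over
    the signs one at a time ([sign_mean], [integral_dyadic_sign_mean]), because
    the two halves of J are dyadic intervals of rank m + 1.  Every probabilistic
    inequality is thus an induction on n whose step compares the value at c
    with the average of the values at c + a and c - a, where a is the next
    coefficient.

    Both bounds concern partial sums.  For the lower bound the passage to f
    needs almost everywhere convergence of the series: Kolmogorov's maximal
    inequality ([kolmogorov_maximal]), again such an induction, gives it in
    [negligible_dvg_rademacher], and [integral_rademacher_sum_ge] transfers
    bounds on level sets of the partial sums to the integral of |f|^p. *)

(** * Rademacher functions on dyadic intervals *)

(** Open, because the Rademacher functions vanish at the dyadic points. *)
Definition dyadic {R : realType} (m j : nat) : set R :=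
  `](j%:R / 2 ^+ m), (j.+1%:R / 2 ^+ m)[.

Lemma measurable_dyadic {R : realType} (m j : nat) :
  measurable (dyadic m j : set R).
Proof. exact: measurable_itv. Qed.

Lemma lebesgue_measure_dyadic {R : realType} (m j : nat) :
  lebesgue_measure (dyadic m j : set R) = (2 ^- m)%:E.
Proof.
rewrite lebesgue_measure_itv /= lte_fin ltr_pM2r ?invr_gt0 ?exprn_gt0//.
by rewrite ltr_nat ltnSn -EFinB -mulrBl -natrB// subSnn mul1r.
Qed.

Lemma dyadic_bounds {R : realType} (m j : nat) (t : R) :
  dyadic m j t <-> j%:R < 2 ^+ m * t < j.+1%:R.
Proof.
have h : (0 : R) < 2 ^+ m by rewrite exprn_gt0.
by rewrite /dyadic /= in_itv /= ltr_pdivrMr// ltr_pdivlMr// mulrC.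
Qed.

Lemma dyadic_child {R : realType} (m j b : nat) :
  (b < 2)%N -> dyadic m.+1 (j.*2 + b) `<=` (dyadic m j : set R).
Proof.
move=> b2 t /dyadic_bounds; rewrite exprS -mulrA => /andP[h1 h2].
have hb : (b%:R : R) <= 1 by rewrite (ler_nat R b 1) -ltnS.
have hb0 : (0 : R) <= b%:R by [].
apply/dyadic_bounds.
move: h1 h2; rewrite -natr1 natrD -muln2 natrM -natr1 => h1 h2.
apply/andP; split; lra.
Qed.

(** The sign of the sine alternates between consecutive intervals of length
    pi. *)
Lemma rademacher_dyadic {R : realType} (k j : nat) (t : R) :
  dyadic k j t -> rademacher k t = (-1) ^+ j.
Proof.
move=> /dyadic_bounds/andP[h1 h2]; rewrite /rademacher.
have -> : 2 ^+ k * pi * t = pi * (2 ^+ k * t - j%:R) + pi *+ j.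
  by rewrite -mulr_natr; ring.
rewrite (alternatingn (@sinDpi R)) sgrM sgrX sgrN1 (gtr0_sg (x := sin _)) ?mulr1//.
apply: sin_gt0_pi; have p0 := pi_gt0 R.
rewrite mulr_gt0 ?subr_gt0//= gtr_pMr//; rewrite -natr1 in h2; lra.
Qed.

(** The index b of a half, 0 on the left and 1 on the right, is the parity of
    its index among the dyadic intervals of rank m + 1. *)
Lemma rademacher_dyadic_child {R : realType} (m j b : nat) (t : R) :
  dyadic m.+1 (j.*2 + b) t -> rademacher m.+1 t = (-1) ^+ b.
Proof.
move=> tJ; rewrite (rademacher_dyadic tJ).
by rewrite exprD -mul2n exprM sqrrN !expr1n mul1r.
Qed.

Lemma measurable_rademacher {R : realType} (k : nat) :
  measurable_fun [set: R] (rademacher k).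
Proof.
have msg : measurable_fun [set: R] (Num.sg : R -> R).
  apply: nondecreasing_measurable => // x y xy.
  by case: (sgrP x) => hx; case: (sgrP y) => hy //; lra.
apply: (measurableT_comp msg).
apply: (@measurableT_comp _ _ _ _ _ _ (@sin R)).
  by apply: continuous_measurable_fun; exact: continuous_sin.
exact: mulrl_measurable.
Qed.

(** The two halves miss only the midpoint, which is a null set. *)
Lemma integral_dyadic_split {R : realType} (m j : nat) (F : R -> \bar R) :
  measurable_fun [set: R] F -> (forall t, 0 <= F t)%E ->
  (\int[lebesgue_measure]_(t in dyadic m j) F t =
   \int[lebesgue_measure]_(t in dyadic m.+1 j.*2) F t +
   \int[lebesgue_measure]_(t in dyadic m.+1 j.*2.+1) F t)%E.
Proof.
move=> mF F0.
have mFD D : measurable_fun D F by exact: measurable_funTS.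
have h : (0 : R) < 2 ^+ m by rewrite exprn_gt0.
have E1 : (j.*2%:R / 2 ^+ m.+1 : R) = j%:R / 2 ^+ m.
  by rewrite -muln2 natrM exprS; field; rewrite lt0r_neq0.
have E2 : (j.*2.+2%:R / 2 ^+ m.+1 : R) = j.+1%:R / 2 ^+ m.
  by rewrite -doubleS -muln2 natrM exprS; field; rewrite lt0r_neq0.
rewrite /dyadic E1 E2; set x := (j.*2.+1%:R / _).
have x1 : j%:R / 2 ^+ m < x.
  by rewrite -E1 ltr_pM2r ?invr_gt0 ?exprn_gt0// ltr_nat.
have x2 : x < j.+1%:R / 2 ^+ m.
  by rewrite -E2 ltr_pM2r ?invr_gt0 ?exprn_gt0// ltr_nat.
rewrite (@itv_bndbnd_setU _ _ _ (BLeft x)) ?bnd_simp//; last exact: ltW.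
rewrite ge0_integral_setU//=.
- congr (_ + _)%E; symmetry; exact: integral_itv_obnd_cbnd.
- exact: mFD.
- apply/disj_setPS => t /= [] /=; rewrite !in_itv/= => /andP[_ a] /andP[b _].
  by have := lt_le_trans a b; rewrite ltxx.
Qed.

Definition rademacher_block {R : realType} (a : nat -> R) (m n : nat) (t : R) :=
  \sum_(m.+1 <= k < (m + n).+1) a k * rademacher k t.

Lemma rademacher_blockS {R : realType} (a : nat -> R) (m n : nat) (t : R) :
  rademacher_block a m n.+1 t =
  a m.+1 * rademacher m.+1 t + rademacher_block a m.+1 n t.
Proof. by rewrite /rademacher_block big_ltn ?addnS ?ltnS ?leq_addr. Qed.

Lemma rademacher_block_cat {R : realType} (a : nat -> R) (m n : nat) (t : R) :
  rademacher_block a 0 (m + n) t =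
  rademacher_block a 0 m t + rademacher_block a m n t.
Proof.
by rewrite /rademacher_block !add0n (big_cat_nat (n := m.+1))// ltnS leq_addr.
Qed.

Lemma measurable_rademacher_block {R : realType} (a : nat -> R) (m n : nat) :
  measurable_fun [set: R] (rademacher_block a m n).
Proof.
apply: measurable_sum => k; apply: measurable_funM => //.
exact: measurable_rademacher.
Qed.

(** * Averages over signs *)

Definition sqsum {R : realType} (a : nat -> R) (m n : nat) : R :=
  \sum_(m.+1 <= k < (m + n).+1) a k ^+ 2.

Lemma sqsumS {R : realType} (a : nat -> R) (m n : nat) :
  sqsum a m n.+1 = a m.+1 ^+ 2 + sqsum a m.+1 n.
Proof. by rewrite /sqsum big_ltn ?addnS ?ltnS ?leq_addr. Qed.

Lemma sqsum_cat {R : realType} (a : nat -> R) (m n : nat) :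
  sqsum a 0 (m + n) = sqsum a 0 m + sqsum a m n.
Proof.
by rewrite /sqsum !add0n (big_cat_nat (n := m.+1))// ltnS leq_addr.
Qed.

Lemma sqsum_ge0 {R : realType} (a : nat -> R) (m n : nat) : 0 <= sqsum a m n.
Proof. by apply: sumr_ge0 => k _; exact: sqr_ge0. Qed.

(** The expectation of phi (c + sum of +- a_k, m < k <= m + n) over independent
    fair signs, computed by averaging over one sign at a time. *)
Fixpoint sign_mean {R : realType} (phi : R -> R) (a : nat -> R) (m n : nat)
    (c : R) : R :=
  if n is n'.+1 then
    (sign_mean phi a m.+1 n' (c + a m.+1) +
     sign_mean phi a m.+1 n' (c - a m.+1)) / 2
  else phi c.

(** On the two halves of a dyadic interval the first term of the block is
    + a_(m+1) and - a_(m+1), so bisection reproduces the recursion that defines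
    [sign_mean].  This is the whole independence of the Rademacher functions. *)
Lemma integral_dyadic_sign_mean {R : realType} (phi : R -> R) (a : nat -> R)
    (m n j : nat) (c : R) :
  measurable_fun [set: R] phi -> (forall x, 0 <= phi x) ->
  (\int[lebesgue_measure]_(t in dyadic m j)
     (phi (c + rademacher_block a m n t))%:E =
   (2 ^- m * sign_mean phi a m n c)%:E)%E.
Proof.
move=> mphi phi0; elim: n m j c => [|n IH] m j c.
  transitivity (\int[lebesgue_measure]_(t in (dyadic m j : set R)) cst (phi c)%:E t)%E.
    apply: eq_integral => t _.
    by rewrite /rademacher_block addn0 big_geq// addr0.
  rewrite integral_cst; last exact: measurable_dyadic.
  transitivity ((phi c)%:E * (2 ^- m)%:E)%E; last by rewrite -EFinM mulrC.
  by congr (_ * _)%E; exact: lebesgue_measure_dyadic.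
rewrite integral_dyadic_split; first last.
- by move=> t; rewrite lee_fin.
- apply/measurable_EFinP; apply: measurableT_comp => //.
  apply: measurable_funD => //; exact: measurable_rademacher_block.
have half b : (\int[lebesgue_measure]_(t in dyadic m.+1 (j.*2 + b))
      (phi (c + rademacher_block a m n.+1 t))%:E)%E =
   (2 ^- m.+1 * sign_mean phi a m.+1 n (c + (-1) ^+ b * a m.+1))%:E.
  rewrite -(IH _ (j.*2 + b)%N); apply: eq_integral => t; rewrite inE => tJ.
  by rewrite rademacher_blockS (rademacher_dyadic_child tJ) addrA [a _ * _]mulrC.
have := half 0%N; have := half 1%N; rewrite addn0 addn1 => -> ->.
rewrite expr0 mul1r expr1 mulN1r /= -EFinD; congr EFin.
by rewrite exprS; field; rewrite expf_neq0.
Qed.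

(** Bounding exp x by 1 / (1 - x) and exp (- x) by 1 / (1 + x) gives twice
    1 / (1 - x^2), which is at most 2 (1 + 2 x^2) for x^2 <= 1/2. *)
Lemma cosh_le_expR_sqr {R : realType} (x : R) :
  x ^+ 2 <= 4^-1 -> expR x + expR (- x) <= 2 * expR (2 * x ^+ 2).
Proof.
move=> hx.
have hx2 : (x + 2^-1) * (2^-1 - x) >= 0.
  have -> : (x + 2^-1) * (2^-1 - x) = 4^-1 - x ^+ 2 by field.
  by rewrite subr_ge0.
have /andP[x1 x2] : - 2^-1 <= x <= 2^-1.
  apply/andP; split; nra.
have inv (y : R) : - 2^-1 <= y -> y <= 2^-1 -> expR y <= (1 - y)^-1.
  move=> y1 y2; rewrite -[leLHS]invrK -expRN lef_pV2 ?posrE ?expR_gt0//; last lra.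
  exact: expR_ge1Dx.
have h1 := inv x x1 x2.
have h2 : expR (- x) <= (1 + x)^-1 by have := inv (- x); rewrite opprK; apply; lra.
have h3 : (1 - x)^-1 + (1 + x)^-1 = 2 / (1 - x ^+ 2).
  by field; rewrite !lt0r_neq0//; nra.
apply: (le_trans (lerD h1 h2)); rewrite h3 ler_pM2l//.
apply: le_trans (expR_ge1Dx (2 * x ^+ 2)).
have : 0 <= x ^+ 2 by exact: sqr_ge0.
move: (x ^+ 2) hx => y hy y0; rewrite -[leLHS]mul1r ler_pdivrMr; nra.
Qed.

(** Averaging cosh (c + a) and cosh (c - a) gives cosh c * cosh a, and each
    factor cosh a costs at most exp (2 a^2).  The smallness assumption is what
    [cosh_le_expR_sqr] needs for every single coefficient; scaling the sequence
    achieves it. *)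
Lemma sign_mean_cosh {R : realType} (a : nat -> R) (m n : nat) (c : R) :
  sqsum a m n <= 4^-1 ->
  sign_mean (fun x => expR x + expR (- x)) a m n c <=
  (expR c + expR (- c)) * expR (2 * sqsum a m n).
Proof.
elim: n m c => [|n IH] m c; rewrite ?sqsumS /=.
  move=> _; rewrite ler_peMr ?addr_ge0 ?expR_ge0//.
  by rewrite -expR0 ler_expR mulr_ge0// sqsum_ge0.
move=> hs.
have s0 := sqsum_ge0 a m.+1 n; have a0 := sqr_ge0 (a m.+1).
have hs' : sqsum a m.+1 n <= 4^-1 by lra.
have ha : a m.+1 ^+ 2 <= 4^-1 by lra.
rewrite ler_pdivrMr//.
apply: le_trans (lerD (IH _ _ hs') (IH _ _ hs')) _.
rewrite -mulrDl (mulrDr 2) (expRD (2 * _)).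
have -> : expR (c + a m.+1) + expR (- (c + a m.+1)) +
   (expR (c - a m.+1) + expR (- (c - a m.+1))) =
   (expR c + expR (- c)) * (expR (a m.+1) + expR (- a m.+1)).
  by rewrite !opprD !opprK !expRD; ring.
have := cosh_le_expR_sqr ha.
have := expR_gt0 (2 * sqsum a m.+1 n); have := expR_gt0 c; have := expR_gt0 (- c).
move: (expR _) => u; move: (expR _) => v; move: (expR (_ * _)) => z.
move: (_ + expR (- a _)) => y; move: (expR _) => y' u0 v0 z0 hy.
have -> : (v + u) * (y' * z) * 2 = (v + u) * (2 * y') * z by ring.
by rewrite ler_pM2r// ler_pM2l// addr_gt0.
Qed.

(** A Paley-Zygmund inequality.  Pointwise
    (4 x^2 - tau) (8 tau - x^2) <= 64 tau^2 * [tau <= 4 x^2]; the left-hand side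
    is - 4 x^4 + 33 tau x^2 - 8 tau^2, and with s the sum of squares of the
    coefficients the second and fourth moments of the random sum started at c
    are c^2 + s and at most c^4 + 6 c^2 s + 3 s^2.  For c = 0 and tau = s the
    bound reads 13 s^2 <= 64 s^2 * probability. *)
Lemma sign_mean_large {R : realType} (a : nat -> R) (tau : R) (m n : nat) (c : R) :
  0 <= tau ->
  - 4 * (c ^+ 4 + 6 * c ^+ 2 * sqsum a m n + 3 * sqsum a m n ^+ 2)
    + 33 * tau * (c ^+ 2 + sqsum a m n) - 8 * tau ^+ 2 <=
  64 * tau ^+ 2 * sign_mean (fun x => (tau <= 4 * x ^+ 2)%R%:R) a m n c.
Proof.
move=> tau0; elim: n m c => [|n IH] m c.
  rewrite /sqsum addn0 big_geq//= expr0n/= !mulr0 !addr0.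
  have -> : c ^+ 4 = (c ^+ 2) ^+ 2 by rewrite -exprM.
  have : 0 <= c ^+ 2 by exact: sqr_ge0.
  move: (c ^+ 2) => y y0; case: (leP tau (4 * y)) => h /=; last nra.
  have := sqr_ge0 (y - 33 / 8 * tau); nra.
rewrite sqsumS /=.
have := IH m.+1 (c + a m.+1); have := IH m.+1 (c - a m.+1).
set s := sqsum _ _ _; set b := a m.+1.
move: (sign_mean _ _ _ _ _) => P; move: (sign_mean _ _ _ _ _) => Q h1 h2.
have h3 : 0 <= 8 * b ^+ 4 by rewrite mulr_ge0// (exprM b 2 2) sqr_ge0.
have -> : 64 * tau ^+ 2 * ((Q + P) / 2) =
  (64 * tau ^+ 2 * P + 64 * tau ^+ 2 * Q) / 2 by field.
rewrite ler_pdivlMr//; apply: le_trans (lerD h1 h2).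
lra.
Qed.

(** Flipping all signs exchanges the sums started at c and, up to a global
    sign, those started at - c.  For c = 0 a random sum is nonnegative with
    probability at least 1/2. *)
Lemma sign_mean_ge0_symmetric {R : realType} (a : nat -> R) (m n : nat) (c : R) :
  1 <= sign_mean (fun x => (0 <= x)%R%:R) a m n c +
       sign_mean (fun x => (0 <= x)%R%:R) a m n (- c).
Proof.
elim: n m c => [|n IH] m c /=.
  by case: (leP 0 c) => h; case: (leP 0 (- c)) => h' //=; lra.
have := IH m.+1 (c + a m.+1); have := IH m.+1 (c - a m.+1).
have -> : - (c + a m.+1) = - c - a m.+1 by ring.
have -> : - (c - a m.+1) = - c + a m.+1 by ring.
lra.
Qed.

(** * Kolmogorov's maximal inequality *)

Lemma measurable_set_gt {R : realType} (x : R) (f : R -> R) :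
  measurable_fun [set: R] f -> measurable [set t | x < f t].
Proof.
move=> mf; rewrite (_ : [set _ | _] = [set: R] `&` f @^-1` `]x, +oo[); last first.
  by apply/seteqP; split => t /=; rewrite in_itv/= andbT//; case.
by apply: mf => //; exact: measurable_itv.
Qed.

Lemma measurable_set_ge {R : realType} (x : R) (f : R -> R) :
  measurable_fun [set: R] f -> measurable [set t | x <= f t].
Proof.
move=> mf; rewrite (_ : [set _ | _] = [set: R] `&` f @^-1` `[x, +oo[); last first.
  by apply/seteqP; split => t /=; rewrite in_itv/= andbT//; case.
by apply: mf => //; exact: measurable_itv.
Qed.

Definition exceed {R : realType} (a : nat -> R) (eps : R) (m n : nat) (c : R) :
  set R :=
  \bigcup_(k < n.+1) [set t | eps < `|c + rademacher_block a m k t|].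

Lemma measurable_exceed {R : realType} (a : nat -> R) (eps : R) (m n : nat) (c : R) :
  measurable (exceed a eps m n c).
Proof.
apply: bigcup_measurable => k _; apply: measurable_set_gt.
apply: measurableT_comp => //; apply: measurable_funD => //.
exact: measurable_rademacher_block.
Qed.

(** If |c| > eps the bound is trivial, its right-hand side being at least the
    measure of the interval.  Otherwise the threshold is passed later, in one of
    the halves with c replaced by c + a or c - a, and the average of
    (c + a)^2 and (c - a)^2 is c^2 + a^2. *)
Lemma kolmogorov_maximal {R : realType} (a : nat -> R) (eps : R) (m n j : nat)
    (c : R) :
  0 < eps ->
  (lebesgue_measure (exceed a eps m n c `&` dyadic m j) <=
   (2 ^- m * ((c ^+ 2 + sqsum a m n) / eps ^+ 2))%:E)%E.
Proof.
move=> eps0; have large m' n' j' c' : eps < `|c'| ->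
    (lebesgue_measure (exceed a eps m' n' c' `&` dyadic m' j') <=
     (2 ^- m' * ((c' ^+ 2 + sqsum a m' n') / eps ^+ 2))%:E)%E.
  move=> hc; have le1 : 1 <= (c' ^+ 2 + sqsum a m' n') / eps ^+ 2.
    rewrite ler_pdivlMr ?exprn_gt0// mul1r ler_wpDr ?sqsum_ge0//.
    by rewrite -[leRHS]real_normK ?num_real// ler_pXn2r ?nnegrE// ltW.
  apply: (@le_trans _ _ (lebesgue_measure (dyadic m' j' : set R))).
    apply: le_measure; rewrite ?inE; [|exact: measurable_dyadic|exact: subIsetr].
    by apply: measurableI; [exact: measurable_exceed|exact: measurable_dyadic].
  by rewrite lebesgue_measure_dyadic lee_fin ler_peMr// invr_ge0 exprn_ge0.
elim: n m j c => [|n IH] m j c; (have [/large//|hc] := ltP eps `|c|).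
- rewrite (_ : _ `&` _ = set0) ?measure0 ?lee_fin.
    rewrite mulr_ge0 ?invr_ge0 ?exprn_ge0// divr_ge0 ?sqr_ge0//.
    by rewrite addr_ge0 ?sqr_ge0 ?sqsum_ge0.
  apply/seteqP; split => // t [[[|//] _ /=]].
  by rewrite /rademacher_block addn0 big_geq// addr0 ltNge hc.
- have half b : (b < 2)%N ->
    (lebesgue_measure (exceed a eps m n.+1 c `&` dyadic m.+1 (j.*2 + b)) <=
     (2 ^- m.+1 * (((c + (-1) ^+ b * a m.+1) ^+ 2 + sqsum a m.+1 n) / eps ^+ 2))%:E)%E.
    move=> b2; apply: le_trans (IH _ (j.*2 + b)%N _).
    apply: le_measure; rewrite ?inE;
      try (by apply: measurableI; [exact: measurable_exceed|exact: measurable_dyadic]).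
    move=> t [[[|k] kn /=]].
      by rewrite /rademacher_block addn0 big_geq// addr0 ltNge hc.
    rewrite rademacher_blockS => h tJ; split => //; exists k => //=.
    by move: h; rewrite (rademacher_dyadic_child tJ) addrA [a _ * _]mulrC.
  rewrite -integral_indic; [|exact: measurable_dyadic|exact: measurable_exceed].
  rewrite integral_dyadic_split; first last.
  + by move=> t; rewrite lee_fin.
  + by apply/measurable_EFinP; exact: measurable_indic (measurable_exceed _ _ _ _ _).
  rewrite !integral_indic; try exact: measurable_dyadic; try exact: measurable_exceed.
  have := half 0%N isT; have := half 1%N isT; rewrite addn0 addn1 => h1 h0.
  apply: (le_trans (leeD h0 h1)); rewrite -EFinD lee_fin sqsumS le_eqVlt.
  apply/orP; left; apply/eqP; rewrite exprS.
  by field; rewrite expf_neq0//= lt0r_neq0.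
Qed.

(** * Almost everywhere convergence *)

Lemma sqsum_tail {R : realType} (a : nat -> R) (B : R) :
  (forall n, sqsum a 0 n <= B) ->
  forall e, 0 < e -> exists N, forall n, sqsum a N n <= e.
Proof.
move=> hB e e0.
have cu : cvgn (sqsum a 0).
  apply: nondecreasing_is_cvgn; last by exists B => _ [n _ <-].
  by move=> x y xy; rewrite -(subnKC xy) sqsum_cat lerDl sqsum_ge0.
have /cvgrPdist_le /(_ (e / 2)) [|N _ hN] := cu; first by rewrite divr_gt0.
exists N => n; have := hN N (leqnn N); have := hN (N + n)%N (leq_addr _ _).
rewrite sqsum_cat /= !ler_norml => /andP[h1 h2] /andP[h3 h4]; lra.
Qed.

(** The maximal inequality for the sequence with its first N terms replaced by
    0 bounds the probability that some partial sum departs by more than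
    1 / (q + 1) from the N-th one; the bound tends to 0 with N for each q. *)
Lemma negligible_dvg_rademacher {R : realType} (a : nat -> R) (B : R) :
  (forall n, sqsum a 0 n <= B) ->
  (@lebesgue_measure R).-negligible
    (dyadic 0 0 `&` [set t | ~ cvgn (fun n => rademacher_block a 0 n t)]).
Proof.
move=> hB.
(* Zeroing the first N terms instead of starting the block at N keeps the whole
   argument on the single interval of rank 0. *)
pose tail N : nat -> R := fun k => if (k <= N)%N then 0 else a k.
have tailE N n t : rademacher_block (tail N) 0 (N + n) t = rademacher_block a N n t.
  rewrite rademacher_block_cat [X in X + _]big_nat big1 ?add0r; last first.
    by move=> k /andP[_]; rewrite /tail ltnS => ->; rewrite mul0r.
  rewrite /rademacher_block !big_nat; apply: eq_bigr => k /andP[Nk _].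
  by rewrite /tail leqNgt Nk.
have tailsq N n : sqsum (tail N) 0 (N + n) = sqsum a N n.
  rewrite sqsum_cat [X in X + _]big_nat big1 ?add0r; last first.
    by move=> k /andP[_]; rewrite /tail ltnS => ->; rewrite expr0n.
  rewrite /sqsum !big_nat; apply: eq_bigr => k /andP[Nk _].
  by rewrite /tail leqNgt Nk.
pose F (q N n : nat) := exceed (tail N) (q.+1%:R^-1) 0 (N + n) 0 `&` dyadic 0 0.
have mF q N n : measurable (F q N n).
  by apply: measurableI; [exact: measurable_exceed|exact: measurable_dyadic].
have mUF q N : measurable (\bigcup_n F q N n) by apply: bigcup_measurable.
have muF q N e : (forall n, sqsum a N n <= e) ->
    (lebesgue_measure (\bigcup_n F q N n) <= (e * q.+1%:R ^+ 2)%:E)%E.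
  move=> he.
  have ndF : nondecreasing_seq (F q N).
    move=> x y xy; rewrite subsetEset => t [[k kx tk] tJ]; split => //.
    by exists k => //; apply: leq_trans kx _; rewrite ltnS leq_add2l.
  have cF : lebesgue_measure (F q N n) @[n --> \oo] -->
      lebesgue_measure (\bigcup_n F q N n).
    by apply: nondecreasing_cvg_mu => //; [exact: mF|exact: mUF].
  rewrite -(cvg_lim (@ereal_hausdorff R) cF); apply: lime_le.
    by apply/cvg_ex; eexists; exact: cF.
  apply: nearW => n /=.
  apply: (le_trans (kolmogorov_maximal _ _ _ _ _ _)); first by rewrite invr_gt0.
  rewrite lee_fin expr0 invr1 mul1r expr0n/= add0r tailsq exprVn invrK.
  by rewrite ler_wpM2r.
apply: (@negligibleS _ _ _ (@lebesgue_measure R)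
    (\bigcup_q \bigcap_N \bigcup_n F q N n)); last first.
  apply: (@negligible_bigcup _ _ _ (@lebesgue_measure R)) => q.
  apply/negligibleP; first by apply: bigcapT_measurable => N; exact: mUF.
  apply/eqP; rewrite eq_le measure_ge0 andbT.
  apply/lee_addgt0Pr => e e0; rewrite add0e.
  have e0' : 0 < e / q.+1%:R ^+ 2 by rewrite divr_gt0// exprn_gt0.
  have [N hN] := sqsum_tail hB e0'.
  apply: (@le_trans _ _ (lebesgue_measure (\bigcup_n F q N n))).
    apply: le_measure; rewrite ?inE; [|exact: mUF|].
      by apply: bigcapT_measurable => M; exact: mUF.
    by move=> t; apply.
  apply: (le_trans (muF q _ _ hN)).
  by rewrite divfK// expf_neq0.
move=> t [tJ]; apply: contra_notP => ht.
(* Outside all the exceptional sets the partial sums are Cauchy. *)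
apply: cauchy_cvg; apply: cauchy_exP => e e0.
have [q _ /(_ q (leqnn _)) /= hq] := near_infty_natSinv_lt (PosNum e0).
have [N hN] : exists N, forall n, `|rademacher_block a N n t| <= q.+1%:R^-1.
  apply: contra_notP ht => /forallNP hN; exists q => // N _.
  have /existsNP[n /negP] := hN N; rewrite -ltNge => hn; exists n => //.
  by split => //; exists (N + n)%N => //=; rewrite add0r tailE.
exists (rademacher_block a 0 N t).
exists N => // n /= Nn; rewrite /ball /= -(subnKC Nn) rademacher_block_cat.
rewrite opprD addrA subrr sub0r normrN.
by apply: le_lt_trans (hN _) _.
Qed.

(** The integral of a nonnegative function is a supremum over the simple
    functions below it, hence monotone without measurability.  This spares the
    measurability of [rademacher_sum]. *)
Lemma le_integral_ge0 {R : realType} (D : set R) (f g : R -> \bar R) :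
  (forall t, D t -> 0 <= f t)%E -> (forall t, D t -> f t <= g t)%E ->
  (\int[lebesgue_measure]_(t in D) f t <= \int[lebesgue_measure]_(t in D) g t)%E.
Proof.
move=> f0 fg.
have fg' t : ((f \_ D) t <= (g \_ D) t)%E.
  by rewrite !patchE; case: ifPn => // /[!inE]; exact: fg.
have f0' t : (0 <= (f \_ D) t)%E.
  by rewrite !patchE; case: ifPn => // /[!inE]; exact: f0.
rewrite integral_mkcond [leRHS]integral_mkcond !ge0_integralTE//; last first.
  by move=> t; exact: le_trans (f0' t) (fg' t).
apply: le_ereal_sup => _ [h hf <-]; exists h => // t.
exact: le_trans (hf t) (fg' t).
Qed.

(** A point lying in infinitely many of the sets where |S_n| >= V, and at which
    S_n converges, satisfies |f| >= V.  The limit superior of these sets has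
    measure at least d by continuity from above. *)
Lemma integral_rademacher_sum_ge {R : realType} (a : nat -> R) (B p V d : R)
    (N : nat) (D : set R) :
  (forall n, sqsum a 0 n <= B) -> measurable D -> D `<=` dyadic 0 0 ->
  0 < p -> 0 <= V ->
  (forall n, (N <= n)%N ->
     (d%:E <= lebesgue_measure
        ([set t | (V <= `|rademacher_block a 0 n t|)%R] `&` D))%E) ->
  ((d * V `^ p)%:E <=
   \int[lebesgue_measure]_(t in D) (`|rademacher_sum a t| `^ p)%:E)%E.
Proof.
move=> hB mD DJ p0 V0 hd.
pose E n := [set t | V <= `|rademacher_block a 0 n t|] `&` D.
have mE n : measurable (E n).
  apply: measurableI => //; apply: measurable_set_ge.
  apply: measurableT_comp => //; exact: measurable_rademacher_block.
have mUE n : measurable (\bigcup_(k >= n) E k) by apply: bigcup_measurable.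
have mL : measurable (lim_sup_set E) by apply: bigcapT_measurable.
have cL : lebesgue_measure (\bigcup_(k >= n) E k) @[n --> \oo] -->
          lebesgue_measure (lim_sup_set E).
  apply: lim_sup_set_cvg => //.
  apply: (@le_lt_trans _ _ (lebesgue_measure (dyadic 0 0 : set R))).
    apply: le_measure; rewrite ?inE; [exact: mUE|exact: measurable_dyadic|].
    by move=> t [k _ [_ /DJ]].
  by rewrite lebesgue_measure_dyadic ltry.
have dL : (d%:E <= lebesgue_measure (lim_sup_set E))%E.
  rewrite -(cvg_lim (@ereal_hausdorff R) cL); apply: lime_ge.
    by apply/cvg_ex; eexists; exact: cL.
  apply: nearW => n; apply: (le_trans (hd _ (leq_maxl N n))).
  apply: le_measure; rewrite ?inE; [exact: (mE (maxn N n))|exact: mUE|].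
  by move=> t tE; exists (maxn N n) => //=; exact: leq_maxr.
have [Z [mZ Z0 hZ]] := negligible_dvg_rademacher hB.
have dLZ : (d%:E <= lebesgue_measure (lim_sup_set E `\` Z))%E.
  apply: (le_trans dL).
  apply: (@le_trans _ _ (lebesgue_measure ((lim_sup_set E `\` Z) `|` Z))).
    apply: le_measure; rewrite ?inE; [exact: mL| |].
      by apply: measurableU => //; exact: measurableD.
    by move=> t tL; have [?|?] := pselect (Z t); [right|left].
  apply: (@le_trans _ _ (lebesgue_measure (lim_sup_set E `\` Z) +
                         lebesgue_measure Z)%E); last by rewrite Z0 adde0.
  by apply: measureU2 => //; exact: measurableD.
have subD : lim_sup_set E `\` Z `<=` D.
  by move=> t [/(_ 0%N I) [k _ []]].
apply: (@le_trans _ _ (\int[lebesgue_measure]_(t in D)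
    ((V `^ p)%:E * (\1_(lim_sup_set E `\` Z) t)%:E))%E).
  rewrite ge0_integralZl_EFin ?powR_ge0//; first last.
    by apply/measurable_EFinP; apply: measurable_indic; exact: measurableD.
  rewrite integral_indic//; last exact: measurableD.
  by rewrite mulrC EFinM lee_wpmul2l ?lee_fin ?powR_ge0// setIidl.
apply: le_integral_ge0 => t Dt; rewrite -EFinM lee_fin indicE.
  by rewrite mulr_ge0 ?powR_ge0.
case: (boolP (t \in _)); rewrite ?(mulr0, mulr1) ?powR_ge0// inE => -[tL tZ].
apply: ge0_ler_powR; rewrite ?nnegrE ?normr_ge0//; first exact: ltW.
have ct : cvgn (fun n => rademacher_block a 0 n t).
  by apply: contra_notP tZ => ct; apply: hZ; split => //; exact: DJ.
rewrite leNgt; apply/negP => hlt.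
have [M _ hM] : \forall n \near \oo, `|rademacher_block a 0 n t| < V.
  have cn : `|rademacher_block a 0 n t| @[n --> \oo] --> `|rademacher_sum a t|.
    by apply: cvg_norm; exact: ct.
  exact: (cvgr_lt _ cn).
have [n Mn [/= h _]] := tL M I.
by have := hM n Mn; rewrite /= ltNge h.
Qed.

(** * Lower bounds for level sets of partial sums *)

Lemma measure_dyadic_sign_mean {R : realType} (P : R -> bool) (a : nat -> R)
    (m n j : nat) :
  measurable [set x | P x] ->
  lebesgue_measure ([set t | P (rademacher_block a m n t)] `&` dyadic m j) =
  (2 ^- m * sign_mean (fun x => (P x)%:R) a m n 0)%:E.
Proof.
move=> mP.
have PE : (fun x => (P x)%:R) = \1_[set x | P x] :> (R -> R).
  apply/funext => x; rewrite indicE; congr ((nat_of_bool _)%:R).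
  by apply/idP/idP; rewrite inE.
have mphi : measurable_fun [set: R] (fun x => (P x)%:R : R).
  by rewrite PE; exact: measurable_indic.
rewrite -(integral_dyadic_sign_mean a m n j 0 mphi)//.
rewrite -integral_indic; [|exact: measurable_dyadic|].
  apply: eq_integral => t _; rewrite add0r indicE; congr ((nat_of_bool _)%:R%:E).
  by apply/idP/idP; rewrite inE.
rewrite -[X in measurable X]setTI.
exact: (@measurable_rademacher_block R a m n measurableT _ mP).
Qed.

(** [sign_mean_large] at c = 0 with tau the sum of the first n squares, which
    dominates the sum of the first N. *)
Lemma measure_block_ge_l2 {R : realType} (a : nat -> R) (N n : nat) :
  (N <= n)%N ->
  ((13 / 64)%:E <= lebesgue_measure
     ([set t | (Num.sqrt (sqsum a 0 N) / 2 <= `|rademacher_block a 0 n t|)%R]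
        `&` dyadic 0 0))%E.
Proof.
move=> Nn; have s0 := sqsum_ge0 a 0 N.
have sN : sqsum a 0 N <= sqsum a 0 n.
  by rewrite -(subnKC Nn) sqsum_cat lerDl sqsum_ge0.
have mV V : measurable [set t | V <= `|rademacher_block a 0 n t|].
  apply: measurable_set_ge; apply: measurableT_comp => //.
  exact: measurable_rademacher_block.
(* Dividing by the square of the sum below requires it to be nonzero. *)
have [sE|s1] := eqVneq (sqsum a 0 N) 0.
  rewrite sE sqrtr0 mul0r (_ : _ `&` _ = dyadic 0 0).
    by rewrite lebesgue_measure_dyadic lee_fin expr0; lra.
  by apply/seteqP; split => t //= [].
have sn : 0 < sqsum a 0 n by apply: lt_le_trans sN; rewrite lt_def s1.
have msq : measurable [set x : R | sqsum a 0 n <= 4 * x ^+ 2].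
  by apply: measurable_set_ge; apply: measurable_funM.
have msqS : measurable [set t | sqsum a 0 n <= 4 * rademacher_block a 0 n t ^+ 2].
  apply: measurable_set_ge; apply: measurable_funM => //.
  by apply: measurable_funX; exact: measurable_rademacher_block.
have h := measure_dyadic_sign_mean
  (P := fun x => sqsum a 0 n <= 4 * x ^+ 2) a 0 n 0 msq.
apply: (@le_trans _ _ (lebesgue_measure
   ([set t | (sqsum a 0 n <= 4 * rademacher_block a 0 n t ^+ 2)%R] `&` dyadic 0 0))%E).
  rewrite h lee_fin expr0 invr1 mul1r.
  have := sign_mean_large a 0 n 0 (sqsum_ge0 a 0 n).
  move: (sign_mean _ _ _ _ _) => P; move: (sqsum a 0 n) sn => s sn.
  rewrite !expr0n/= !(mulr0, mul0r, add0r) => hP.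
  have s2 : 0 < s ^+ 2 by rewrite exprn_gt0.
  rewrite -(ler_pM2l s2); nra.
apply: le_measure; rewrite ?inE.
- by apply: measurableI; [exact: msqS|exact: measurable_dyadic].
- by apply: measurableI; [exact: mV|exact: measurable_dyadic].
move=> t [/= ht tJ]; split => //=.
have q0 := sqrtr_ge0 (sqsum a 0 N).
rewrite -(@ler_pXn2r _ 2) ?nnegrE ?divr_ge0// real_normK ?num_real//.
rewrite expr_div_n sqr_sqrtr//; lra.
Qed.

(** The interval is found by bisection, going at each step to the half where
    the next Rademacher function has the sign of its coefficient. *)
Lemma aligned_dyadic {R : realType} (a : nat -> R) (m : nat) :
  exists2 j, dyadic m j `<=` (dyadic 0 0 : set R) &
    forall t, dyadic m j t ->
      rademacher_block a 0 m t = \sum_(1 <= k < m.+1) `|a k|.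
Proof.
elim: m => [|m [j hj IH]].
  by exists 0%N => // t _; rewrite /rademacher_block !big_geq.
(* b = 0 selects the left half, where the next Rademacher function is 1. *)
pose b := (a m.+1 < 0)%R : nat.
have b2 : (b < 2)%N by rewrite /b; case: (_ < _).
exists (j.*2 + b)%N => [|t tJ]; first exact: subset_trans (dyadic_child b2) hj.
have -> : rademacher_block a 0 m.+1 t =
    rademacher_block a 0 m t + rademacher_block a m 1 t.
  by rewrite -rademacher_block_cat addn1.
rewrite (IH t (dyadic_child b2 tJ)) [RHS]big_nat_recr//=; congr (_ + _).
rewrite /rademacher_block addn1 big_nat1 (rademacher_dyadic_child tJ) /b.
by case: (ltrgt0P (a m.+1)) => h; rewrite ?expr0 ?expr1 ?mulr1 ?mulrN1 ?h.
Qed.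

(** The tail is nonnegative on at least half of the interval, where it can only
    increase the sum of the aligned first m terms. *)
Lemma measure_block_ge_l1 {R : realType} (a : nat -> R) (m j n : nat) :
  (forall t : R, dyadic m j t ->
     rademacher_block a 0 m t = \sum_(1 <= k < m.+1) `|a k|) ->
  (m <= n)%N ->
  ((2 ^- m / 2)%:E <= lebesgue_measure
     ([set t | (\sum_(1 <= k < m.+1) `|a k| <= `|rademacher_block a 0 n t|)%R]
        `&` dyadic m j))%E.
Proof.
move=> hj mn.
have m0 : measurable [set x : R | 0 <= x] by exact: measurable_set_ge.
have h := measure_dyadic_sign_mean (P := fun x => 0 <= x) a m (n - m) j m0.
apply: (@le_trans _ _ (lebesgue_measure
   ([set t | (0 <= rademacher_block a m (n - m) t)%R] `&` dyadic m j))%E).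
  rewrite h lee_fin ler_pM2l ?invr_gt0 ?exprn_gt0//.
  have := sign_mean_ge0_symmetric a m (n - m) 0; rewrite oppr0; lra.
have mb x y : measurable_fun [set: R] (rademacher_block a x y).
  exact: measurable_rademacher_block.
apply: le_measure; rewrite ?inE.
- apply: measurableI; last exact: measurable_dyadic.
  by apply: measurable_set_ge; exact: mb.
- apply: measurableI; last exact: measurable_dyadic.
  by apply: measurable_set_ge; apply: measurableT_comp => //; exact: mb.
move=> t [/= ht tJ]; split => //=.
rewrite -(subnKC mn) rademacher_block_cat hj// (le_trans _ (ler_norm _))//.
by rewrite lerDl.
Qed.

(** * Subintervals and the Morrey norm *)

Lemma measure_subinterval01 {R : realType} (I : set R) :
  nondeg_subinterval01 I ->
  let l := fine (lebesgue_measure I) in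
  [/\ measurable I, 0 < l, l <= 1 & lebesgue_measure I = l%:E].
Proof.
move=> [iI I01 I0] l.
have mI : measurable I by exact: is_interval_measurable.
have I1 : (lebesgue_measure I <= 1%:E)%E.
  apply: (@le_trans _ _ (lebesgue_measure (`[0, 1]%classic : set R))).
    by apply: le_measure; rewrite ?inE//; exact: measurable_itv.
  by rewrite lebesgue_measure_itv /= lte_fin ltr01 oppr0 adde0.
have fI : lebesgue_measure I \is a fin_num.
  by rewrite ge0_fin_numE ?measure_ge0// (le_lt_trans I1) ?ltry.
have lE : lebesgue_measure I = l%:E by rewrite fineK.
by split=> //; [rewrite -lte_fin -lE|rewrite -lee_fin -lE].
Qed.

Lemma dyadic_nondeg {R : realType} (m j : nat) :
  dyadic m j `<=` (dyadic 0 0 : set R) -> nondeg_subinterval01 (dyadic m j : set R).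
Proof.
move=> h; split; first exact: interval_is_interval.
  move=> t /h; rewrite /dyadic /= expr0 !divr1 !in_itv/= => /andP[? ?].
  by rewrite !ltW.
by rewrite lebesgue_measure_dyadic lte_fin invr_gt0 exprn_gt0.
Qed.

Lemma morrey_norm_ge {R : realType} (p : R) (w f : R -> R) (I : set R)
    (c V : R) :
  0 < p -> (forall t : R, 0 <= t <= 1 -> 0 <= w t) -> nondeg_subinterval01 I ->
  0 <= c -> 0 <= V ->
  ((c * fine (lebesgue_measure I) * V `^ p)%:E <=
     \int[lebesgue_measure]_(t in I) (`|f t| `^ p)%:E)%E ->
  ((w (fine (lebesgue_measure I)) * (c `^ p^-1 * V))%:E <= morrey_norm p w f)%E.
Proof.
move=> p0 w0 nI c0 V0.
have [mI l0 l1 lE] := measure_subinterval01 nI; set l := fine _ in l0 l1 lE *.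
move=> h; apply: (@le_trans _ _ ((w l)%:E *
  (l^-1%:E * \int[lebesgue_measure]_(t in I) (`|f t| `^ p)%:E) `^ p^-1)%E);
  last first.
  by apply: ereal_sup_ubound; exists I.
rewrite EFinM; apply: lee_wpmul2l; first by rewrite lee_fin w0// l1 ltW.
have -> : (c `^ p^-1 * V)%:E = ((l^-1 * (c * l * V `^ p))%:E `^ p^-1)%E.
  rewrite poweR_EFin; congr EFin.
  have -> : l^-1 * (c * l * V `^ p) = c * V `^ p by field; rewrite lt0r_neq0.
  by rewrite powRM ?powR_ge0// -powRrM mulfV ?lt0r_neq0// powRr1.
have i0 : (0 <= \int[lebesgue_measure]_(t in I) (`|f t| `^ p)%:E)%E.
  by apply: integral_ge0 => t _; rewrite lee_fin powR_ge0.
apply: gt0_ler_poweR; rewrite ?invr_ge0 ?(ltW p0)//.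
- rewrite in_itv/= leey andbT lee_fin mulr_ge0 ?invr_ge0 ?(ltW l0)//.
  by rewrite !mulr_ge0 ?powR_ge0// ltW.
- by rewrite in_itv/= leey andbT mule_ge0// lee_fin invr_ge0 ltW.
by rewrite EFinM lee_wpmul2l// lee_fin invr_ge0 ltW.
Qed.

(** * Upper bounds for integrals over intervals *)

Lemma limn_einf_ge_einfs {R : realType} (u : (\bar R)^nat) n :
  (einfs u n <= limn_einf u)%E.
Proof.
rewrite limn_einf_lim (cvg_lim (@ereal_hausdorff R) (@cvg_einfs_sup R u)).
by apply: ereal_sup_ubound; exists n.
Qed.

Lemma limn_einf_le_bound {R : realType} (u : (\bar R)^nat) (x : \bar R) :
  (forall n, u n <= x)%E -> (limn_einf u <= x)%E.
Proof.
move=> ux; rewrite limn_einf_lim; apply: lime_le; first exact: is_cvg_einfs.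
by apply: nearW => n; apply: le_trans (ux n); apply: ereal_inf_lbound; exists n => /=.
Qed.

Lemma powR_le_limn_einf {R : realType} (p l : R) (u : R^nat) :
  0 < p -> 0 <= l -> u @ \oo --> l ->
  ((l `^ p)%:E <= limn_einf (fun n => (u n `^ p)%:E))%E.
Proof.
move=> p0 l0 ul.
have [->|l1] := eqVneq l 0.
  rewrite powR0 ?lt0r_neq0//.
  apply: le_trans (limn_einf_ge_einfs _ 0%N).
  by apply: le_ereal_inf_tmp => _ [n _ <-]; rewrite lee_fin powR_ge0.
have l2 : 0 < l by rewrite lt_def l1.
have cp : {for l, continuous ((@powR R)^~ p)}.
  apply: differentiable_continuous; apply/derivable1_diffP.
  by apply: derivable_powR; rewrite in_itv/= andbT.
have up : (u n `^ p)%:E @[n --> \oo] --> (l `^ p)%:E.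
  by apply/cvg_EFin; [exact: nearW|exact: (continuous_cvg _ cp ul)].
by rewrite (cvg_limn_einf_sup up).1.
Qed.

(** This is u / p <= exp (u / p) raised to the power p. *)
Lemma powR_le_expR {R : realType} (p u : R) :
  0 < p -> 0 <= u -> u `^ p <= p `^ p * expR u.
Proof.
move=> p0 u0.
have h : u / p <= expR (u / p).
  by apply: le_trans (expR_ge1Dx _); rewrite lerDr.
have -> : expR u = expR (u / p) `^ p.
  by rewrite -expRM divfK// lt0r_neq0.
rewrite -powRM ?expR_ge0 ?(ltW p0)//; apply: ge0_ler_powR; first exact: ltW.
- by rewrite nnegrE.
- by rewrite nnegrE mulr_ge0 ?expR_ge0// ltW.
by rewrite mulrC -ler_pdivrMr.
Qed.

(** The factors come from [powR_le_expR], from the constant part of the sum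
    (bounded by 1 after scaling) and from [sign_mean_cosh] at c = 0. *)
Definition upper_cst {R : realType} (p : R) : R :=
  p `^ p * expR 1 * (2 * expR (2 * 4^-1)).

(** Divide by M.  The first m terms then contribute at most 1 and the sum of
    squares of the others is at most 1/4, so that the p-th power of the sum is
    dominated by an exponential to which [sign_mean_cosh] applies. *)
Lemma integral_block_powR_le {R : realType} (p M : R) (a : nat -> R) (m n j : nat) :
  0 < p -> 0 < M ->
  \sum_(1 <= k < m.+1) `|a k| <= M -> 4 * sqsum a m n <= M ^+ 2 ->
  (\int[lebesgue_measure]_(t in dyadic m j)
     (`|rademacher_block a 0 (m + n) t| `^ p)%:E <=
   (M `^ p * upper_cst p * 2 ^- m)%:E)%E.
Proof.
move=> p0 M0 hM h4.
pose b k := a k / M.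
have bE t : rademacher_block a m n t = M * rademacher_block b m n t.
  rewrite /rademacher_block big_distrr/=; apply: eq_bigr => k _.
  by rewrite /b; field; rewrite lt0r_neq0.
have hb : sqsum b m n <= 4^-1.
  rewrite /sqsum (eq_bigr (fun k => a k ^+ 2 / M ^+ 2)); last first.
    by move=> k _; rewrite expr_div_n.
  rewrite -big_distrl/= ler_pdivrMr ?exprn_gt0//.
  by move: h4; rewrite /sqsum; lra.
have Sm t : `|rademacher_block a 0 m t| <= M.
  apply: le_trans hM; apply: (le_trans (ler_norm_sum _ _ _)).
  apply: ler_sum => k _; rewrite normrM ler_piMr//.
  by rewrite /rademacher; case: sgrP; rewrite ?normr0 ?normrN ?normr1.
pose phi (x : R) := expR x + expR (- x).
have mexp : measurable_fun [set: R] (@expR R).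
  by apply: continuous_measurable_fun; exact: continuous_expR.
have mphi : measurable_fun [set: R] phi.
  apply: measurable_funD => //; apply: measurableT_comp => //.
have phi0 x : 0 <= phi x by rewrite addr_ge0 ?expR_ge0.
have mb x y c : measurable_fun [set: R] (rademacher_block c x y).
  exact: measurable_rademacher_block.
pose K := M `^ p * (p `^ p * expR 1).
have K0 : 0 <= K by rewrite !mulr_ge0 ?powR_ge0 ?expR_ge0.
have ptw t : `|rademacher_block a 0 (m + n) t| `^ p <=
    K * phi (0 + rademacher_block b m n t).
  rewrite add0r; set x := rademacher_block b m n t.
  have h1 : `|rademacher_block a 0 (m + n) t| <= M * (1 + `|x|).
    rewrite rademacher_block_cat bE (le_trans (ler_normD _ _))//.
    by rewrite mulrDr mulr1 lerD// normrM gtr0_norm.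
  have h2 : expR `|x| <= phi x.
    by rewrite /phi; case: (ger0P x) => _; rewrite ?lerDl ?lerDr expR_ge0.
  apply: (@le_trans _ _ ((M * (1 + `|x|)) `^ p)).
    by apply: ge0_ler_powR; rewrite ?nnegrE ?(ltW p0)// mulr_ge0 ?addr_ge0// ltW.
  rewrite powRM ?addr_ge0 ?(ltW M0)// /K -!mulrA ler_wpM2l ?powR_ge0//.
  apply: (le_trans (powR_le_expR p0 _)); first by rewrite addr_ge0.
  by rewrite expRD ler_wpM2l ?powR_ge0// ler_wpM2l ?expR_ge0.
apply: (@le_trans _ _ (\int[lebesgue_measure]_(t in dyadic m j)
   (K%:E * (phi (0 + rademacher_block b m n t))%:E))%E).
  apply: le_integral_ge0 => t _; first by rewrite lee_fin powR_ge0.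
  by rewrite -EFinM lee_fin ptw.
rewrite ge0_integralZl_EFin//; first last.
- apply/measurable_EFinP; apply: measurable_funTS; apply: measurableT_comp => //.
  by apply: measurable_funD => //; exact: mb.
- by move=> t _; rewrite lee_fin.
- exact: measurable_dyadic.
rewrite (integral_dyadic_sign_mean b m n j 0 mphi phi0) -EFinM lee_fin.
rewrite /upper_cst (_ : _ * 2 ^- m = K * (2 ^- m * (2 * expR (2 * 4^-1)))); last first.
  by rewrite /K; ring.
rewrite ler_wpM2l// ler_wpM2l ?invr_ge0 ?exprn_ge0//.
apply: (le_trans (sign_mean_cosh 0 hb)); rewrite oppr0 expR0.
by rewrite (_ : 1 + 1 = 2)// ler_wpM2l// ler_expR ler_wpM2l.
Qed.

Lemma dyadic_scale {R : realType} (l : R) :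
  0 < l -> l <= 1 -> exists m, l <= 2 ^- m /\ 2 ^- m < 2 * l.
Proof.
move=> l0 l1.
have ex : exists n, 2 ^- n < l.
  have li0 : 0 <= l^-1 by rewrite invr_ge0 ltW.
  have := archi_boundP li0; set n := Num.bound _ => hn.
  exists n; rewrite -[ltRHS]invrK ltf_pV2 ?posrE ?invr_gt0 ?exprn_gt0//.
  by rewrite (lt_trans hn)// -natrX ltr_nat ltn_expl.
case: (ex_minnP ex) => -[|m] hm hmin.
  by move: hm; rewrite expr0 invr1 ltNge l1.
exists m; split; first by rewrite leNgt; apply/negP => /hmin; rewrite ltnn.
move: hm; rewrite exprS invfM; lra.
Qed.

(** The infimum of I lies in some [j 2^-m, (j + 1) 2^-m[, and I extends to the
    right of it by at most |I|.  The second interval of the pair may lie outside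
    [0, 1]: the Rademacher functions are given by the same formula there. *)
Lemma subset_dyadic_pair {R : realType} (I : set R) (m : nat) :
  nondeg_subinterval01 I -> fine (lebesgue_measure I) <= 2 ^- m ->
  exists j : nat, I `<=` `[(j%:R / 2 ^+ m), (j.+2%:R / 2 ^+ m)[.
Proof.
move=> nI; have [mI l0 l1 lE] := measure_subinterval01 nI.
set l := fine _ in l0 l1 lE * => lm.
have [iI I01 I0] := nI.
have [x0 Ix0] : I !=set0.
  by apply/set0P/eqP => I00; move: I0; rewrite I00 measure0 ltxx.
have lb0 : lbound I 0 by move=> y /I01; rewrite /= in_itv/= => /andP[].
have hI : has_inf I by split; [exists x0|exists 0].
have i0 : 0 <= inf I by apply: lb_le_inf => //; exists x0.
have diam x y : I x -> I y -> y - x <= l.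
  move=> Ix Iy; have [yx|xy] := leP y x.
    by rewrite (le_trans _ (ltW l0))// subr_le0.
  rewrite -lee_fin -lE.
  apply: (@le_trans _ _ (lebesgue_measure (`[x, y]%classic : set R))).
    by rewrite lebesgue_measure_itv /= lte_fin xy.
  apply: le_measure; rewrite ?inE; [exact: measurable_itv|exact: mI|].
  by move=> z /=; rewrite in_itv/=; exact: iI.
have infl y : I y -> y <= inf I + l.
  move=> Iy; rewrite -lerBlDr; apply: lb_le_inf; first by exists x0.
  by move=> x Ix; have := diam x y Ix Iy; lra.
have e0 : (0 : R) < 2 ^+ m by rewrite exprn_gt0.
have /andP[j1 j2] := truncn_itv (mulr_ge0 i0 (ltW e0)).
exists (Num.trunc (inf I * 2 ^+ m)) => y Iy.
have y1 : inf I <= y by apply: ge_inf => //; exists 0.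
rewrite /= in_itv/= ler_pdivrMr// (le_trans j1) ?ler_pM2r//=.
rewrite ltr_pdivlMr//.
have y2 : y * 2 ^+ m <= (inf I + l) * 2 ^+ m by rewrite ler_pM2r// infl.
apply: (le_lt_trans y2); rewrite mulrDl -[X in _ < X]natr1 ltr_leD//.
by rewrite -ler_pdivlMr// mul1r.
Qed.

(** By Fatou's lemma it suffices to bound the partial sums.  Where they diverge
    the default value 0 of the limit keeps |f|^p below the limit inferior. *)
Lemma integral_rademacher_sum_le {R : realType} (p M : R) (a : nat -> R) (I : set R)
    (m : nat) :
  0 < p -> 0 < M -> nondeg_subinterval01 I ->
  let l := fine (lebesgue_measure I) in
  l <= 2 ^- m -> 2 ^- m < 2 * l ->
  \sum_(1 <= k < m.+1) `|a k| <= M -> (forall n, 4 * sqsum a m n <= M ^+ 2) ->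
  (\int[lebesgue_measure]_(t in I) (`|rademacher_sum a t| `^ p)%:E <=
   (4 * upper_cst p * l * M `^ p)%:E)%E.
Proof.
move=> p0 M0 nI l lm ml hM h4.
have [mI l0 l1 lE] := measure_subinterval01 nI.
pose S n t := (`|rademacher_block a 0 (m + n) t| `^ p)%:E.
have mS n : measurable_fun [set: R] (S n).
  apply/measurable_EFinP.
  apply: (measurableT_comp (measurable_powR p)).
  by apply: measurableT_comp => //; exact: measurable_rademacher_block.
have S0 n t : (0 <= S n t)%E by rewrite lee_fin powR_ge0.
apply: (@le_trans _ _ (\int[lebesgue_measure]_(t in I) limn_einf (S ^~ t))%E).
  apply: le_integral_ge0 => t It; first by rewrite lee_fin powR_ge0.
  have [ct|ct] := pselect (cvgn (fun n => rademacher_block a 0 n t)).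
    apply: powR_le_limn_einf => //.
    apply: cvg_norm; apply: (cvg_comp (addn m) (fun n => rademacher_block a 0 n t)).
      exact: cvg_addnl.
    exact: ct.
  have -> : rademacher_sum a t = 0 by exact: (dvgP ct).
  rewrite normr0 powR0 ?lt0r_neq0//.
  apply: le_trans (limn_einf_ge_einfs _ 0%N).
  by apply: le_ereal_inf_tmp => _ [n _ <-]; exact: S0.
apply: (@le_trans _ _ (limn_einf (fun n => \int[lebesgue_measure]_(t in I) S n t))%E).
  by apply: fatou => // n; apply: measurable_funTS; exact: mS.
apply: limn_einf_le_bound => n.
have [j Ij] := subset_dyadic_pair nI lm.
have e0 : (0 : R) < 2 ^+ m by rewrite exprn_gt0.
pose h i : R := i%:R / 2 ^+ m.
have itvE i : (\int[lebesgue_measure]_(t in `[(h i), (h i.+1)[) S n t =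
   \int[lebesgue_measure]_(t in dyadic m i) S n t)%E.
  by symmetry; apply: integral_itv_obnd_cbnd; apply: measurable_funTS; exact: mS.
apply: (@le_trans _ _ (\int[lebesgue_measure]_(t in
    `[(h j), (h j.+2)[) S n t)%E).
  apply: ge0_subset_integral; [exact: mI|exact: measurable_itv| |by []|exact: Ij].
  by apply: measurable_funTS; exact: mS.
rewrite (@itv_bndbnd_setU _ _ _ (BLeft (h j.+1))) ?bnd_simp; first last.
- by rewrite ler_pM2r ?invr_gt0// ler_nat.
- by rewrite ler_pM2r ?invr_gt0// ler_nat.
rewrite ge0_integral_setU//=; first last.
- apply/disj_setPS => t /= [] /=; rewrite !in_itv/= => /andP[_ x] /andP[y _].
  by have := lt_le_trans x y; rewrite ltxx.
- by apply: measurable_funTS; exact: mS.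
rewrite !itvE.
apply: (le_trans (leeD (integral_block_powR_le j p0 M0 hM (h4 n))
   (integral_block_powR_le j.+1 p0 M0 hM (h4 n)))).
have c0 : 0 <= upper_cst p by rewrite /upper_cst !mulr_ge0 ?powR_ge0 ?expR_ge0.
rewrite -EFinD lee_fin.
have -> : 4 * upper_cst p * l * M `^ p = (M `^ p * upper_cst p) * (4 * l) by ring.
rewrite -mulrDr ler_wpM2l ?mulr_ge0 ?powR_ge0//; lra.
Qed.

(** * The two-sided estimate *)

(** The last clause lets bounds on finite sections pass to the l_2 norm. *)
Lemma l2norm_fin {R : realType} (a : nat -> R) :
  (l2norm a < +oo)%E -> exists A, [/\ 0 <= A, l2norm a = A%:E,
    forall n, sqsum a 0 n <= A ^+ 2 &
    forall r, 0 <= r -> (forall n, Num.sqrt (sqsum a 0 n) <= r) -> A <= r].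
Proof.
rewrite /l2norm; set T := (\sum_(1 <= k <oo) _)%E => Tlt.
have u0 n : (0 <= ((a n) ^+ 2)%:E :> \bar R)%E by rewrite lee_fin sqr_ge0.
have T0 : (0 <= T)%E by apply: nneseries_ge0.
have fT : T \is a fin_num.
  by rewrite -sqrte_fin_num// ge0_fin_numE// sqrte_ge0.
have sumE n : (\sum_(1 <= k < n.+1) ((a k) ^+ 2)%:E = (sqsum a 0 n)%:E)%E.
  by rewrite sumEFin.
have sT n : ((sqsum a 0 n)%:E <= T)%E.
  by rewrite -sumE; apply: nneseries_lim_ge => k _ _; exact: u0.
move: fT sT T0; rewrite /T; case TE : (limn _) => [tau| |]// _ sT T0.
exists (Num.sqrt tau); split => //.
  by move=> n; rewrite sqr_sqrtr -?lee_fin.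
move=> r r0 hr; rewrite -[leRHS]ger0_norm// -sqrtr_sqr ler_wsqrtr//.
rewrite -lee_fin -TE; apply: lime_le; first exact: is_cvg_nneseries.
exists 1%N => // -[//|n] _ /=; rewrite sumE lee_fin.
rewrite -[leLHS]sqr_sqrtr ?sqsum_ge0// ler_pXn2r ?nnegrE//.
Qed.

Lemma weighted_l1_sup_ub {R : realType} (w : R -> R) (a : nat -> R) (m : nat) :
  (0 < m)%N ->
  ((w (2 ^- m) * \sum_(1 <= k < m.+1) `|a k|)%:E <= weighted_l1_sup w a)%E.
Proof. by move=> m0; apply: ereal_sup_ubound; exists m. Qed.

Lemma exprn2V_le1 {R : realType} m : 0 <= (2 : R) ^- m <= 1.
Proof. by rewrite invr_ge0 exprn_ge0//= invf_le1 ?exprn_gt0// exprn_ege1// ler1n. Qed.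

Lemma weighted_l1_sup_ge0 {R : realType} (w : R -> R) (a : nat -> R) :
  (forall t : R, 0 <= t <= 1 -> 0 <= w t) -> (0 <= weighted_l1_sup w a)%E.
Proof.
move=> w0; apply: le_trans (@weighted_l1_sup_ub R w a 1 isT).
by rewrite lee_fin mulr_ge0 ?w0 ?exprn2V_le1// sumr_ge0.
Qed.

(** The value 1/8 lies below both 13/64 and 1/2, the proportions provided by
    [measure_block_ge_l2] and [measure_block_ge_l1]. *)
Lemma morrey_norm_lower {R : realType} (p : R) (w : R -> R) (a : nat -> R) (A : R) :
  0 < p -> (forall t : R, 0 <= t <= 1 -> 0 <= w t) -> w 1 = 1 ->
  (forall n, sqsum a 0 n <= A ^+ 2) ->
  (forall n, ((8^-1 `^ p^-1 * (Num.sqrt (sqsum a 0 n) / 2))%:E <=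
     morrey_norm p w (rademacher_sum a))%E) /\
  (forall m, ((8^-1 `^ p^-1 * (w (2 ^- m) * \sum_(1 <= k < m.+1) `|a k|))%:E <=
     morrey_norm p w (rademacher_sum a))%E).
Proof.
move=> p0 w0 w1 hA.
have key V d m j N : dyadic m j `<=` (dyadic 0 0 : set R) -> 0 <= V ->
    8^-1 * 2 ^- m <= d ->
    (forall n, (N <= n)%N ->
     (d%:E <= lebesgue_measure
        ([set t | (V <= `|rademacher_block a 0 n t|)%R] `&` dyadic m j))%E) ->
    ((w (2 ^- m) * (8^-1 `^ p^-1 * V))%:E <= morrey_norm p w (rademacher_sum a))%E.
  move=> sub V0 hd hV.
  have lE : fine (lebesgue_measure (dyadic m j : set R)) = 2 ^- m.
    by rewrite lebesgue_measure_dyadic.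
  have := @morrey_norm_ge _ p w (rademacher_sum a) (dyadic m j) 8^-1 V p0 w0
    (dyadic_nondeg sub); rewrite lE; apply => //.
  apply: le_trans (integral_rademacher_sum_ge hA (measurable_dyadic m j) sub p0 V0 hV).
  by rewrite lee_fin ler_wpM2r// powR_ge0.
split=> [N|m].
  have := key (Num.sqrt (sqsum a 0 N) / 2) (13 / 64) 0%N 0%N N.
  rewrite expr0 invr1 w1 mul1r; apply => //.
  - lra.
  - by move=> n; exact: measure_block_ge_l2.
have [j sub hj] := aligned_dyadic a m.
have := key (\sum_(1 <= k < m.+1) `|a k|) (2 ^- m / 2) m j m sub.
rewrite mulrCA; apply.
- exact: sumr_ge0.
- have /andP[+ _] := @exprn2V_le1 R m; lra.
- by move=> n; exact: measure_block_ge_l1.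
Qed.

Definition morrey_upper_cst {R : realType} (p : R) : R :=
  (4 * upper_cst p) `^ p^-1.

(** For |I| about 2^-m the mean is bounded through
    B = sum_(k <= m) |a_k|, and w(|I|) B <= w(2^-m) B by monotonicity; for m = 0
    there is no such term in the supremum, but then B = 0. *)
Lemma morrey_norm_upper {R : realType} (p : R) (w : R -> R) (a : nat -> R) (A : R) :
  0 < p -> (forall t : R, 0 <= t <= 1 -> 0 <= w t) ->
  (forall s t : R, 0 <= s -> s <= t -> t <= 1 -> w s <= w t) -> w 1 = 1 ->
  0 <= A -> (forall n, sqsum a 0 n <= A ^+ 2) ->
  (morrey_norm p w (rademacher_sum a) <=
   (2 * morrey_upper_cst p)%:E * (A%:E + weighted_l1_sup w a))%E.
Proof.
move=> p0 w0 wmono w1 A0 hA; set D := morrey_upper_cst p; set W := weighted_l1_sup w a.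
have D0 : 0 <= D by exact: powR_ge0.
have c0 : 0 <= upper_cst p by rewrite /upper_cst !mulr_ge0 ?powR_ge0 ?expR_ge0.
apply: ge_ereal_sup => _ [I nI <-] /=.
have [mI l0 l1 lE] := measure_subinterval01 nI; set l := fine _ in l0 l1 lE *.
have [m [lm ml]] := dyadic_scale l0 l1.
set B := \sum_(1 <= k < m.+1) `|a k|.
have B0 : 0 <= B by exact: sumr_ge0.
have wl0 : 0 <= w l by rewrite w0// l1 ltW.
have wl1 : w l <= 1 by rewrite -w1 wmono// ltW.
have wBW : ((w l * B)%:E <= W)%E.
  case: (posnP m) => [m0|m0].
    by rewrite /B m0 big_geq// mulr0 weighted_l1_sup_ge0.
  apply: le_trans (weighted_l1_sup_ub w a m0); rewrite lee_fin ler_wpM2r//.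
  by have /andP[_ e1] := @exprn2V_le1 R m; rewrite wmono// ltW.
apply: (@le_trans _ _ (w l * (D * (B + 2 * A)))%:E); last first.
  apply: (@le_trans _ _ ((2 * D)%:E * (A%:E + (w l * B)%:E))%E).
    rewrite -EFinD -EFinM lee_fin.
    have -> : w l * (D * (B + 2 * A)) = D * (w l * B + 2 * (w l * A)) by ring.
    rewrite [2 * D]mulrC -[leRHS]mulrA ler_wpM2l//.
    have := mulr_ge0 wl0 B0.
    have : 0 <= A * (1 - w l) by rewrite mulr_ge0// subr_ge0.
    lra.
  by rewrite lee_wpmul2l ?lee_fin ?mulr_ge0// leeD2l.
rewrite EFinM lee_wpmul2l//.
(* The scaling factor M must be positive, but B + 2 A is 0 for the zero
   sequence; a small d > 0 is added and then removed. *)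
apply/lee_addgt0Pr => e e0.
set d := e / (D + 1).
have d0 : 0 < d by rewrite divr_gt0// ltr_wpDl.
have M0 : 0 < B + 2 * A + d by rewrite ltr_wpDl// addr_ge0// mulr_ge0.
have hBM : B <= B + 2 * A + d by lra.
have hAM n : 4 * sqsum a m n <= (B + 2 * A + d) ^+ 2.
  apply: (@le_trans _ _ ((2 * A) ^+ 2)).
    rewrite exprMn -natrX ler_wpM2l//; apply: le_trans (hA (m + n)%N).
    by rewrite sqsum_cat lerDr sqsum_ge0.
  by rewrite ler_pXn2r ?nnegrE//; lra.
have h := integral_rademacher_sum_le p0 M0 nI lm ml hBM hAM.
apply: (@le_trans _ _ ((D * (B + 2 * A + d))%:E)); last first.
  rewrite -EFinD lee_fin mulrDr lerD2l /d mulrA ler_pdivrMr ?ltr_wpDl//.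
  rewrite mulrDr mulr1 mulrC lerDl; exact: ltW.
have -> : (D * (B + 2 * A + d))%:E =
    ((l^-1 * (4 * upper_cst p * l * (B + 2 * A + d) `^ p))%:E `^ p^-1)%E.
  rewrite poweR_EFin; congr EFin.
  set M := B + 2 * A + d in M0 *.
  have -> : l^-1 * (4 * upper_cst p * l * M `^ p) = 4 * upper_cst p * M `^ p.
    by field; rewrite lt0r_neq0.
  have cc : 0 <= 4 * upper_cst p by rewrite mulr_ge0.
  rewrite (powRM _ cc (powR_ge0 M p)) -(powRrM M) mulfV ?lt0r_neq0// powRr1//.
  exact: ltW.
have i0 : (0 <= \int[lebesgue_measure]_(t in I) (`|rademacher_sum a t| `^ p)%:E)%E.
  by apply: integral_ge0 => t _; rewrite lee_fin powR_ge0.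
apply: gt0_ler_poweR; rewrite ?invr_ge0 ?(ltW p0)//.
- by rewrite in_itv/= leey andbT mule_ge0// lee_fin invr_ge0 ltW.
- rewrite in_itv/= leey andbT lee_fin mulr_ge0 ?invr_ge0 ?(ltW l0)//.
  by rewrite !mulr_ge0 ?powR_ge0// ltW.
by rewrite EFinM lee_wpmul2l// lee_fin invr_ge0 ltW.
Qed.

Unset Implicit Arguments.

Theorem theorem1 (R : realType) (p : R) (w : R -> R)
    (p_gt0 : 0 < p)
    (w_ge0 : forall t : R, 0 <= t <= 1 -> 0 <= w t)
    (w_ndecr : forall s t : R, 0 <= s -> s <= t -> t <= 1 -> w s <= w t)
    (w1 : w 1 = 1)
    (w_doubling : exists C0 : R, 1 <= C0 /\
       forall t : R, 0 < t <= 2^-1 -> w (2 * t) <= C0 * w t) :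
  exists C : R, 1 <= C /\
    forall a : nat -> R, (l2norm a < +oo)%E ->
      ((C^-1)%:E * (l2norm a + weighted_l1_sup w a)
         <= morrey_norm p w (rademacher_sum a))%E /\
      (morrey_norm p w (rademacher_sum a)
         <= C%:E * (l2norm a + weighted_l1_sup w a))%E.
Proof.
pose D : R := 2 * morrey_upper_cst p.
pose c : R := 8^-1 `^ p^-1.
have D0 : 0 <= D by rewrite mulr_ge0// powR_ge0.
have c0 : 0 < c by rewrite powR_gt0.
have c3 : 0 < 3 / c by rewrite divr_gt0.
exists (1 + D + 3 / c); split; first by rewrite -addrA lerDl addr_ge0// ltW.
move=> a /l2norm_fin[A [A0 -> hA hsup]].
have W0 := weighted_l1_sup_ge0 a w_ge0.
split; last first.
  apply: le_trans (morrey_norm_upper p_gt0 w_ge0 w_ndecr w1 A0 hA) _.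
  rewrite lee_wpmul2r ?adde_ge0// lee_fin -/D; lra.
have [lo2 lo1] := morrey_norm_lower p_gt0 w_ge0 w1 hA.
rewrite -/c in lo1 lo2.
set N := morrey_norm _ _ _ in lo1 lo2 *.
have N0 : (0 <= N)%E.
  apply: le_trans (lo2 0%N); rewrite lee_fin mulr_ge0 ?divr_ge0 ?sqrtr_ge0//.
  exact: ltW.
have hN2 : ((c / 2 * A)%:E <= N)%E.
  case NE : N N0 lo2 => [r| |]// r0 lo2; last by rewrite leey.
  rewrite lee_fin in r0.
  rewrite lee_fin mulrC -ler_pdivlMr ?divr_gt0//; apply: hsup.
    by rewrite divr_ge0// divr_ge0// ltW.
  move=> n; have := lo2 n; rewrite lee_fin ler_pdivlMr ?divr_gt0//; lra.
have hN1 : (c%:E * weighted_l1_sup w a <= N)%E.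
  rewrite muleC -lee_pdivlMr//; apply: ge_ereal_sup => _ [m _ <-].
  by rewrite lee_pdivlMr// -EFinM mulrC.
(* Two thirds of the weight go to the l_2 part, whose bound has an extra factor
   1/2, and one third to the weighted l_1 part. *)
have cle : (1 + D + 3 / c)^-1 <= c / 3.
  by rewrite -[leRHS]invf_div lef_pV2 ?posrE; lra.
apply: (@le_trans _ _ ((c / 3)%:E * (A%:E + weighted_l1_sup w a))%E).
  by rewrite lee_wpmul2r ?adde_ge0.
rewrite ge0_muleDr//.
have -> : ((c / 3)%:E * weighted_l1_sup w a =
    (3^-1)%:E * (c%:E * weighted_l1_sup w a))%E.
  by rewrite muleA -EFinM mulrC.
have -> : ((c / 3)%:E * A%:E = (2 / 3)%:E * (c / 2 * A)%:E)%E.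
  by rewrite -!EFinM; congr EFin; field.
have -> : N = ((2 / 3)%:E * N + (3^-1)%:E * N)%E.
  rewrite -ge0_muleDl ?lee_fin//.
  by rewrite -EFinD (_ : 2 / 3 + 3^-1 = 1) ?mul1e//; field.
by apply: leeD; rewrite lee_wpmul2l// lee_fin; lra.
Qed.
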